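(* Let $R$ be a commutative semiring, let $U$ be a supertropical monoid, and let $\varphi:R\to U$ be a tangibly surjective m-supervaluation, i.e. $\mathcal T(U)\subset\varphi(R)$. Put $N:=\varphi(R)$, which is a submonoid of $U$ containing $\mathcal T(U)$, let $\tau_{U,N}:\widetilde U(N)\to U$ be the unfolding of $U$ along $N$, and for $x\in N$ let $\tilde x\in\widetilde U(N)$ be the tangible lift of $x$ with respect to $N$. (i) The map $\tilde\varphi:R\to\widetilde U(N)$, $a\mapsto\widetilde{\varphi(a)}$, is a tangible m-supervaluation (called the tangible lift of $\varphi$). (ii) If $\varphi':R\to U'$ is a tangible m-supervaluation ($U'$ a supertropical monoid) dominating $\varphi$, then $\varphi'$ dominates $\tilde\varphi$.
   Context: A supertropical monoid is a commutative monoid $(U,\cdot)$ with absorbing element $0$ and a distinguished idempotent $e=e_U$ such that $ex=0$ implies $x=0$, together with a total ordering on $eU$ compatible with multiplication ($a\le b\Rightarrow ac\le bc$) and with $0\le a$ for all $a\in eU$. Then $eU$ is a bipotent semiring with unit $e$ and addition $a+b=\max(a,b)$. $\mathcal T(U):=U\setminus eU$ (tangible elements), $\mathcal T(U)_0:=\mathcal T(U)\cup\{0\}$; elements of $eU$ are called ghost. $U$ is unfolded if $\mathcal T(U)_0$ is closed under multiplication. The unfolding along $N$: let $M:=eU$, let $N$ be a submonoid of $U$ containing $\mathcal T(U)_0$, let $x\mapsto\tilde x$ be a monoid isomorphism from $N$ onto a copy $\widetilde N$. Then $\widetilde U(N)$ is the disjoint union of $\widetilde N$ and $M$ with $\tilde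 0$ and $0_M$ identified, so $\widetilde U(N)=\widetilde N\cup M$, $\widetilde N\cap M=\{0\}$. Multiplication: products within $\widetilde N$ and within $M$ as given there, and $\tilde x\cdot y=(ex)y\in M$ for $x\in N$, $y\in M$. The unit is $\tilde 1$, the distinguished idempotent is $e\in M$, and $M$ has the given ordering. This is an unfolded supertropical monoid with $e\,\widetilde U(N)=M$, $\mathcal T(\widetilde U(N))_0=\widetilde N$ and $e\tilde x=ex$. The map $\tau_{U,N}:\widetilde U(N)\to U$ is given by $\tilde x\mapsto x$ ($x\in N$), $y\mapsto y$ ($y\in M$). The element $\tilde x$ is the tangible lift of $x$. An m-valuation on $R$ is a map $v:R\to M$ to a bipotent semiring $M$ with $v(0)=0$, $v(1)=1$, $v(ab)=v(a)v(b)$, $v(a+b)\le v(a)+v(b)$ $(=\max)$. An m-supervaluation on $R$ is a map $\varphi:R\to U$ to a supertropical monoid with $\varphi(0)=0$, $\varphi(1)=1$, $\varphi(ab)=\varphi(a)\varphi(b)$ such that $e\varphi:R\to eU$, $a\mapsto e\varphi(a)$, is an m-valuation. It is tangible if $\varphi(R)\subset\mathcal T(U)_0$. For m-supervaluations $\varphi:R\to U$ and $\psi:R\to V$ on $R$, $\varphi$ dominates $\psi$ (written $\varphi\ge\psi$) if for all $a,b\in R$: $\varphi(a)=\varphi(b)\Rightarrow\psi(a)=\psi(b)$; $e\varphi(a)\le e\varphi(b)\Rightarrow e\psi(a)\le e\psi(b)$; $\varphi(a)\in eU\Rightarrow\psi(a)\in eV$. *)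

(* Defs.v *)
From HB Require Import structures.
From mathcomp Require Import all_boot all_order all_algebra.
From mathcomp Require Import boolp.

Set Implicit Arguments.
Unset Strict Implicit.
Unset Printing Implicit Defensive.

Import Order.TTheory GRing.Theory.

(* The operations of a supertropical monoid U are written multiplicatively,   *)
(* in group_scope: zerog and eghost are its absorbing element 0 and its       *)
(* distinguished idempotent e. The ideal eU is ghost_set as a predicate on U  *)
(* and ghosts U as a type, and toghost x is ex seen as an element of eU.      *)

HB.mixin Record ComPzSemiRing_isBipotent M of GRing.ComPzSemiRing M := {
  add_bipotent : forall a b : M, (a + b = a \/ a + b = b)%R
}.

#[short(type="bipotentSemiRingType")]
HB.structure Definition BipotentSemiRing :=
  {M of ComPzSemiRing_isBipotent M & GRing.ComPzSemiRing M}.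

Definition bple (M : bipotentSemiRingType) (a b : M) : bool := (a + b == b)%R.

Section MValuation.
Local Open Scope ring_scope.

Definition m_valuation (R : comPzSemiRingType) (M : bipotentSemiRingType)
    (v : R -> M) : Prop :=
  [/\ v 0 = 0, v 1 = 1, {morph v : a b / a * b} &
      forall a b, bple (v (a + b)) (v a + v b)].

End MValuation.

Local Open Scope group_scope.

(* The part of the structure that does not mention the ordering of eU: it has *)
(* to come first, for the ordering to be a relation on the type of ghosts.    *)
HB.mixin Record Monoid_isPreSupertropical U of Monoid U := {
  stmulC : @commutative U U *%g;
  zerog : U;
  mul0g : @left_zero U U zerog *%g;
  eghost : U;
  eghost_idem : eghost * eghost = eghost;
  eghost_eq0 : forall x : U, eghost * x = zerog -> x = zerog
}.

#[short(type="preSupertropicalType")]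
HB.structure Definition PreSupertropical :=
  {U of Monoid_isPreSupertropical U & Monoid U}.

Section Ghosts.
Variable U : preSupertropicalType.
Implicit Types x y : U.

Definition ghost_set : {pred U} :=
  [pred x | `[< exists y, x = eghost * y >]].
Definition tangible : {pred U} := [pred x | x \notin ghost_set].
Definition tangible0 : {pred U} :=
  [pred x | (x \in tangible) || (x == zerog)].

Lemma ghostE x : (x \in ghost_set) = (eghost * x == x).
Proof.
apply/asboolP/eqP => [[y ->]|<-]; last by exists x.
by rewrite mulgA eghost_idem.
Qed.

Lemma mulg0 x : x * zerog = zerog.
Proof. by rewrite stmulC mul0g. Qed.

Definition ghosts := {x : U | x \in ghost_set}.
HB.instance Definition _ := Choice.on ghosts.
HB.instance Definition _ := SubType.on ghosts.

Lemma toghost_subproof x : eghost * x \in ghost_set.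
Proof. by apply/asboolP; exists x. Qed.
Definition toghost x : ghosts := Sub (eghost * x) (toghost_subproof x).

Lemma gmul_subproof (a b : ghosts) : val a * val b \in ghost_set.
Proof.
by rewrite ghostE mulgA; move: (valP a); rewrite ghostE => /eqP->.
Qed.
Definition gmul (a b : ghosts) : ghosts :=
  Sub (val a * val b) (gmul_subproof a b).

Lemma gzero_subproof : zerog \in ghost_set.
Proof. by rewrite ghostE mulg0. Qed.
Definition gzero : ghosts := Sub zerog gzero_subproof.

Lemma gone_subproof : eghost \in ghost_set.
Proof. by rewrite ghostE eghost_idem. Qed.
Definition gone : ghosts := Sub eghost gone_subproof.

Lemma toghostK (a : ghosts) : toghost (val a) = a.
Proof. by apply/val_inj => /=; apply/eqP; rewrite -ghostE; exact: valP. Qed.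

Lemma toghostM x y : toghost (x * y) = gmul (toghost x) (toghost y).
Proof.
apply/val_inj => /=.
by rewrite -mulgA (mulgA x) (stmulC x eghost) -mulgA (mulgA eghost eghost)
  eghost_idem.
Qed.

Lemma toghost0 : toghost zerog = gzero.
Proof. by apply/val_inj; rewrite /= mulg0. Qed.

Lemma toghost1 : toghost 1 = gone.
Proof. by apply/val_inj; rewrite /= mulg1. Qed.

Lemma toghost_eq0 x : toghost x = gzero -> x = zerog.
Proof. by move/(congr1 val)/eghost_eq0. Qed.

Lemma gmulA : associative gmul.
Proof. by move=> a b c; apply/val_inj; rewrite /= mulgA. Qed.
Lemma gmulC : commutative gmul.
Proof. by move=> a b; apply/val_inj; rewrite /= stmulC. Qed.
Lemma gmul1g : left_id gone gmul.
Proof.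
by move=> a; apply/val_inj => /=; apply/eqP; rewrite -ghostE; exact: valP.
Qed.
Lemma gmul0g : left_zero gzero gmul.
Proof. by move=> a; apply/val_inj; rewrite /= mul0g. Qed.

End Ghosts.

Arguments ghost_set {U}.
Arguments tangible {U}.
Arguments tangible0 {U}.
Arguments gzero {U}.
Arguments gone {U}.

HB.mixin Record PreSupertropical_isSupertropical U of PreSupertropical U := {
  gle : rel (ghosts U);
  gle_anti : antisymmetric gle;
  gle_trans : transitive gle;
  gle_total : total gle;
  gle_mul2r : forall a b c, gle a b -> gle (gmul a c) (gmul b c);
  gle0g : forall a, gle gzero a
}.

#[short(type="supertropicalMonoidType")]
HB.structure Definition SupertropicalMonoid :=
  {U of PreSupertropical_isSupertropical U & PreSupertropical U}.

Section GhostSemiring.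
Variable U : supertropicalMonoidType.
Local Notation M := (ghosts U).

Lemma gle_refl : reflexive (@gle U).
Proof. by move=> a; have := gle_total a a; rewrite orbb. Qed.

Fact ghost_display : Order.disp_t.
Proof. exact: Order.Disp. Qed.

HB.instance Definition _ :=
  Order.Le_isPOrder.Build ghost_display M gle_refl gle_anti gle_trans.
HB.instance Definition _ :=
  Order.POrder_isTotal.Build ghost_display M gle_total.

Lemma gadd0g : left_id (@gzero U) Order.max.
Proof. by move=> a; apply/max_idPr; exact: gle0g. Qed.

HB.instance Definition _ :=
  GRing.isNmodule.Build M maxA maxC gadd0g.

Lemma gmulDl : left_distributive (@gmul U) Order.max.
Proof.
move=> a b c; wlog ab : a b / (a <= b)%O.
  by move=> H; case/orP: (le_total a b) => /H // ba; rewrite maxC ba maxC.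
by rewrite !max_r //; exact: gle_mul2r.
Qed.

HB.instance Definition _ := GRing.Nmodule_isComPzSemiRing.Build M
  (@gmulA U) (@gmulC U) (@gmul1g U) gmulDl (@gmul0g U).

Lemma gadd_bipotent (a b : M) : (a + b = a \/ a + b = b)%R.
Proof.
rewrite /GRing.add /=.
by case: (leP a b) => _; [right|left].
Qed.

HB.instance Definition _ := ComPzSemiRing_isBipotent.Build M gadd_bipotent.

(* The ordering of eU as a bipotent semiring is the given one.                *)
Lemma bple_ghost (a b : M) : bple a b = (a <= b)%O.
Proof. by rewrite /bple; exact/eqP/max_idPr. Qed.

End GhostSemiring.

Record unfolding_monoid (U : supertropicalMonoidType) := UnfoldingMonoid {
  unfolding_pred :> {pred U};
  unfolding_monoid_closed : monoid_closed unfolding_pred;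
  unfolding_tangible0 : {subset tangible0 <= unfolding_pred}
}.

Section Unfolding.
Variables (U : supertropicalMonoidType) (N : unfolding_monoid U).
Local Notation M := (ghosts U).
Local Notation sN := {x : U | x \in (N : {pred U})}.

(* The zero of eU is left out of the right summand, so that 0 is represented  *)
(* by the zero of N only.                                                     *)
Definition unfolding : Type := (sN + {y : M | y != 0%R})%type.
HB.instance Definition _ := Choice.on unfolding.

Lemma sN0_subproof : zerog \in (N : {pred U}).
Proof. by apply: unfolding_tangible0; rewrite inE eqxx orbT. Qed.
Definition sN0 : sN := Sub zerog sN0_subproof.
Definition sN1 : sN := Sub 1 (unfolding_monoid_closed N).1.
Definition sN_mul (x y : sN) : sN :=
  Sub (val x * val y) ((unfolding_monoid_closed N).2 _ _ (valP x) (valP y)).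

Definition tlift (x : sN) : unfolding := inl x.
Definition gincl (y : M) : unfolding :=
  if insub y is Some z then inr z else tlift sN0.

Definition unf_mul (u v : unfolding) : unfolding :=
  match u, v with
  | inl x, inl y => tlift (sN_mul x y)
  | inl x, inr y => gincl (toghost (val x) * val y)%R
  | inr x, inl y => gincl (toghost (val y) * val x)%R
  | inr x, inr y => gincl (val x * val y)%R
  end.

Definition tau (u : unfolding) : U :=
  match u with inl x => val x | inr y => val (val y) end.

Lemma gincl0 : gincl 0%R = tlift sN0.
Proof. by rewrite /gincl insubF // eqxx. Qed.

Variant unf_spec : unfolding -> Type :=
  | UnfLift x : unf_spec (tlift x)
  | UnfGhost y : unf_spec (gincl y).

Lemma unfP u : unf_spec u.
Proof.
case: u => [x|y]; first exact: UnfLift.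
suff -> : inr y = gincl (val y) by exact: UnfGhost.
by rewrite /gincl valK.
Qed.

Lemma tau_tlift x : tau (tlift x) = val x. Proof. by []. Qed.

Lemma tau_gincl y : tau (gincl y) = val y.
Proof.
by rewrite /gincl; case: insubP => [z _ <-//|]; rewrite negbK => /eqP->.
Qed.

Lemma tlift_inj : injective tlift. Proof. by move=> x y []. Qed.

Lemma gincl_inj : injective gincl.
Proof. by move=> x y /(congr1 tau); rewrite !tau_gincl => /val_inj. Qed.

Lemma tlift_gincl x y : tlift x = gincl y -> val x = zerog /\ y = 0%R.
Proof.
rewrite /gincl; case: insubP => [z _ _ //|]; rewrite negbK => /eqP -> [->].
by [].
Qed.

Lemma unf_mulTT x y : unf_mul (tlift x) (tlift y) = tlift (sN_mul x y).
Proof. by []. Qed.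

Lemma unf_mulTG x y :
  unf_mul (tlift x) (gincl y) = gincl (toghost (val x) * y)%R.
Proof.
rewrite {1}/gincl; case: insubP => [z _ <- //|]; rewrite negbK => /eqP -> /=.
rewrite mulr0 gincl0; congr inl; apply: val_inj; exact: mulg0.
Qed.

Lemma unf_mulC : commutative unf_mul.
Proof.
move=> [x|x] [y|y] //=; last by rewrite mulrC.
congr inl; apply: val_inj; exact: stmulC.
Qed.

Lemma unf_mulGG x y : unf_mul (gincl x) (gincl y) = gincl (x * y)%R.
Proof.
rewrite {1}/gincl; case: insubP => [z _ <- |].
  rewrite {1}/gincl; case: insubP => [w _ <- //|]; rewrite negbK => /eqP -> /=.
  by rewrite toghost0 mulr0 mul0r.
by rewrite negbK => /eqP ->; rewrite unf_mulTG toghost0 !mul0r.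
Qed.

Lemma unf_mulGT x y :
  unf_mul (gincl y) (tlift x) = gincl (toghost (val x) * y)%R.
Proof. by rewrite unf_mulC unf_mulTG. Qed.

Let toghost_sN x y :
  toghost (val (sN_mul x y)) = (toghost (val x) * toghost (val y))%R.
Proof. exact: toghostM. Qed.

Lemma unf_mulA : associative unf_mul.
Proof.
move=> u v w; case: (unfP u) => x; case: (unfP v) => y; case: (unfP w) => z;
  rewrite ?(unf_mulTT, unf_mulTG, unf_mulGT, unf_mulGG, toghost_sN).
- congr inl; apply: val_inj; exact: mulgA.
- by rewrite mulrA.
- by rewrite mulrCA.
- by rewrite mulrA.
- by rewrite mulrCA mulrA.
- by rewrite mulrCA mulrA.
- by rewrite mulrCA.
- by rewrite mulrA.
Qed.

Lemma unf_mul1g : left_id (tlift sN1) unf_mul.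
Proof.
move=> u; case: (unfP u) => x; rewrite ?unf_mulTT ?unf_mulTG.
  by congr inl; apply: val_inj; exact: mul1g.
by rewrite /= toghost1 mul1r.
Qed.

Lemma unf_mulg1 : right_id (tlift sN1) unf_mul.
Proof. by move=> u; rewrite unf_mulC unf_mul1g. Qed.

HB.instance Definition _ :=
  isMonoid.Build unfolding unf_mulA unf_mul1g unf_mulg1.

Lemma unf_mul0g : left_zero (tlift sN0) unf_mul.
Proof.
by move=> u; case: (unfP u) => x;
  rewrite -gincl0 ?unf_mulGT ?unf_mulGG ?mulr0 ?mul0r.
Qed.

Lemma unf_e_idem : unf_mul (gincl 1%R) (gincl 1%R) = gincl 1%R.
Proof. by rewrite unf_mulGG mul1r. Qed.

Lemma unf_e_eq0 u : unf_mul (gincl 1%R) u = tlift sN0 -> u = tlift sN0.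
Proof.
case: (unfP u) => x; rewrite ?unf_mulGT ?unf_mulGG ?mulr1 ?mul1r -gincl0 //.
by move/gincl_inj/toghost_eq0 => x0; rewrite gincl0; congr inl; apply: val_inj.
Qed.

HB.instance Definition _ := Monoid_isPreSupertropical.Build unfolding
  unf_mulC unf_mul0g unf_e_idem unf_e_eq0.

Lemma unf_eT x : eghost * tlift x = gincl (toghost (val x)).
Proof. by rewrite [LHS]unf_mulGT mulr1. Qed.

Lemma unf_eG y : eghost * gincl y = gincl y.
Proof. by rewrite [LHS]unf_mulGG mul1r. Qed.

Lemma unf_ghostP (u : unfolding) :
  reflect (exists y, u = gincl y) (u \in ghost_set).
Proof.
apply: (iffP (asboolP _)) => [[v ->]|[y ->]]; last first.
  by exists (gincl y); rewrite unf_eG.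
case: (unfP v) => x; first by exists (toghost (val x)); rewrite unf_eT.
by exists x; rewrite unf_eG.
Qed.

Lemma unf_tangible0P (u : unfolding) :
  reflect (exists x, u = tlift x) (u \in tangible0).
Proof.
apply: (iffP orP) => [[|/eqP ->]|[x ->]]; last 1 first.
- case: (unf_ghostP (tlift x)) => [[y xy]|xNghost]; last first.
    by left; apply/negP => /unf_ghostP.
  right; have [x0 _] := tlift_gincl xy.
  by apply/eqP; congr inl; apply: val_inj.
- case: (unfP u) => x; first by exists x.
  by rewrite inE (introT (unf_ghostP _)) //; exists x.
- by exists sN0.
Qed.

Lemma unf_unfolded :
  {in @tangible0 unfolding &, forall u v, u * v \in tangible0}.
Proof.
move=> _ _ /unf_tangible0P[x ->] /unf_tangible0P[y ->].
by apply/unf_tangible0P; exists (sN_mul x y).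
Qed.

(* The ordering of eU, transported along gincl (see unf_gleE): tau maps the   *)
(* ghosts of the unfolding to eU, where toghost is the identity.              *)
Definition unf_gle : rel (ghosts unfolding) :=
  fun a b => (toghost (tau (val a)) <= toghost (tau (val b)))%O.

Lemma ghosts_gincl (a : ghosts unfolding) : exists y, val a = gincl y.
Proof. exact/unf_ghostP/valP. Qed.

Lemma unf_gleE (a b : ghosts unfolding) x y :
  val a = gincl x -> val b = gincl y -> unf_gle a b = (x <= y)%O.
Proof. by rewrite /unf_gle => -> ->; rewrite !tau_gincl !toghostK. Qed.

Lemma unf_gle_anti : antisymmetric unf_gle.
Proof.
move=> a b; have [x ax] := ghosts_gincl a; have [y bY] := ghosts_gincl b.
rewrite (unf_gleE ax bY) (unf_gleE bY ax) => /le_anti xy.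
by apply: val_inj; rewrite ax bY xy.
Qed.

Lemma unf_gle_trans : transitive unf_gle.
Proof. by move=> b a c; exact: le_trans. Qed.

Lemma unf_gle_total : total unf_gle.
Proof. by move=> a b; exact: le_total. Qed.

Lemma unf_gle_mul2r a b c : unf_gle a b -> unf_gle (gmul a c) (gmul b c).
Proof.
have [x ax] := ghosts_gincl a; have [y bY] := ghosts_gincl b.
have [z cz] := ghosts_gincl c.
have acE : val (gmul a c) = gincl (x * z)%R by rewrite /= ax cz [LHS]unf_mulGG.
have bcE : val (gmul b c) = gincl (y * z)%R by rewrite /= bY cz [LHS]unf_mulGG.
rewrite (unf_gleE ax bY) (unf_gleE acE bcE); exact: gle_mul2r.
Qed.

Lemma unf_gle0g a : unf_gle gzero a.
Proof. by rewrite /unf_gle /= toghost0; exact: gle0g. Qed.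

HB.instance Definition _ := PreSupertropical_isSupertropical.Build unfolding
  unf_gle_anti unf_gle_trans unf_gle_total unf_gle_mul2r unf_gle0g.

End Unfolding.

Section MSupervaluation.
Variable R : comPzSemiRingType.

Definition m_supervaluation (U : supertropicalMonoidType) (phi : R -> U) :
    Prop :=
  [/\ phi 0%R = zerog, phi 1%R = 1,
      forall a b : R, phi (a * b)%R = phi a * phi b &
      m_valuation (fun a => toghost (phi a))].

Definition is_tangible (U : supertropicalMonoidType) (phi : R -> U) : Prop :=
  forall a, phi a \in tangible0.

Definition tangibly_surjective (U : supertropicalMonoidType) (phi : R -> U) :
    Prop :=
  forall x, x \in tangible -> exists a, phi a = x.

Definition dominates (U V : supertropicalMonoidType)
    (phi : R -> U) (psi : R -> V) : Prop :=
  [/\ forall a b, phi a = phi b -> psi a = psi b,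
      forall a b, (toghost (phi a) <= toghost (phi b))%O ->
                  (toghost (psi a) <= toghost (psi b))%O &
      forall a, phi a \in ghost_set -> psi a \in ghost_set].

Section TangibleLift.
Variables (U : supertropicalMonoidType) (phi : R -> U).
Hypotheses (phiP : m_supervaluation phi) (phiS : tangibly_surjective phi).

Definition image_pred : {pred U} := [pred x | `[< exists a, phi a = x >]].

Lemma mem_image_pred a : phi a \in image_pred.
Proof. by apply/asboolP; exists a. Qed.

Lemma image_pred_monoid_closed : monoid_closed image_pred.
Proof.
case: phiP => _ phi1 phiM _; split; first by rewrite -phi1 mem_image_pred.
by move=> _ _ /asboolP[a <-] /asboolP[b <-]; rewrite -phiM mem_image_pred.
Qed.

Lemma image_pred_tangible0 : {subset tangible0 <= image_pred}.
Proof.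
case: phiP => phi0 _ _ _ x /orP[/phiS[a <-]|/eqP ->].
  exact: mem_image_pred.
by rewrite -phi0 mem_image_pred.
Qed.

Definition image_monoid : unfolding_monoid U :=
  UnfoldingMonoid image_pred_monoid_closed image_pred_tangible0.

Definition tangible_lift (a : R) : unfolding image_monoid :=
  @tlift U image_monoid (Sub (phi a) (mem_image_pred a)).

End TangibleLift.

End MSupervaluation.

(* Main.v *)
Require Import Defs.
From HB Require Import structures.
From mathcomp Require Import all_boot all_order all_algebra.

Set Implicit Arguments.
Unset Strict Implicit.
Unset Printing Implicit Defensive.

Import Order.TTheory GRing.Theory.

(** The lift from [N] to its copy is an injective monoid morphism fixing 0, and [e] times the lift
    of [x] is [e * x] in [eU]. So lifting [phi] keeps its multiplicativity and, up to [gincl], its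
    ghost part [e phi], which is an m-valuation. For the same reason the first two conditions of
    dominance pass from [phi] to its lift. The third holds because a tangible [phi'] has no ghost
    value except 0. *)

(** Reduces subadditivity to comparisons of single ghosts, which [le_toghost_tlift] can move between
    the unfolding and [U]. *)
Lemma bple_addE (U : supertropicalMonoidType) (a b c : ghosts U) :
  bple a (b + c)%R = (a <= b)%O || (a <= c)%O.
Proof. by rewrite bple_ghost le_max. Qed.

Lemma tangible0_ghost_eq0 (U : preSupertropicalType) (x : U) :
  x \in tangible0 -> x \in ghost_set -> x = zerog.
Proof. by case/orP => [/negP //|/eqP]. Qed.

Lemma le_toghost_tlift (U : supertropicalMonoidType) (N : unfolding_monoid U)
    (x y : {x : U | x \in (N : {pred U})}) :
  (toghost (tlift x) <= toghost (tlift y))%O =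
    (toghost (val x) <= toghost (val y))%O.
Proof.
exact: (@unf_gleE U N (toghost (tlift x)) (toghost (tlift y)) _ _
  (unf_eT x) (unf_eT y)).
Qed.

Section TangibleLiftTheory.
Variables (R : comPzSemiRingType) (U : supertropicalMonoidType) (phi : R -> U).
Variables (phiP : m_supervaluation phi) (phiS : tangibly_surjective phi).
Local Notation phit := (tangible_lift phiP phiS).

(** The lift of [phi a] carries a membership proof built from [a]; [val_inj] makes it irrelevant. *)
Lemma tangible_lift_eq a b : phi a = phi b -> phit a = phit b.
Proof. by move=> ab; congr inl; apply: val_inj. Qed.

Lemma tangible_lift0 : phit 0%R = zerog.
Proof. by congr inl; apply: val_inj; have [] := phiP. Qed.

Lemma tangible_lift1 : phit 1%R = 1%g.
Proof. by congr inl; apply: val_inj; have [] := phiP. Qed.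

Lemma tangible_liftM a b : phit (a * b)%R = (phit a * phit b)%g.
Proof. by congr inl; apply: val_inj; have [_ _ phiM _] := phiP; apply: phiM. Qed.

Lemma tangible_lift_supervaluation : m_supervaluation phit.
Proof.
split; [exact: tangible_lift0 | exact: tangible_lift1 | |].
  exact: tangible_liftM.
split.
- by rewrite tangible_lift0 toghost0.
- by rewrite tangible_lift1 toghost1.
- by move=> a b; rewrite tangible_liftM toghostM.
- move=> a b; rewrite bple_addE !le_toghost_tlift -bple_addE.
  have [_ _ _ [_ _ _ phiD]] := phiP; exact: phiD.
Qed.

Lemma tangible_lift_tangible : is_tangible phit.
Proof. by move=> a; apply/unf_tangible0P; eexists. Qed.

(** Nonzero ghost values of [phi] become tangible after lifting, so the ghost condition rests on the
    tangibility of [phi']. *)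
Lemma dominates_tangible_lift (U' : supertropicalMonoidType) (phi' : R -> U') :
  m_supervaluation phi' -> is_tangible phi' -> dominates phi' phi ->
  dominates phi' phit.
Proof.
case=> phi'0 _ _ _ phi'T [eq_phi le_phi _]; split.
- by move=> a b /eq_phi/tangible_lift_eq.
- by move=> a b /le_phi; rewrite le_toghost_tlift.
(* A ghost value of the tangible phi' is 0 = phi' 0, so phi a = phi 0. *)
- move=> a /(tangible0_ghost_eq0 (phi'T a)); rewrite -phi'0.
  by move=> /eq_phi/tangible_lift_eq ->; rewrite tangible_lift0 gzero_subproof.
Qed.

End TangibleLiftTheory.

Theorem theorem1p10 (R : comPzSemiRingType) (U : supertropicalMonoidType)
    (phi : R -> U) (phiP : m_supervaluation phi)
    (phiS : tangibly_surjective phi) :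
  (m_supervaluation (tangible_lift phiP phiS) /\
   is_tangible (tangible_lift phiP phiS)) /\
  (forall (U' : supertropicalMonoidType) (phi' : R -> U'),
     m_supervaluation phi' -> is_tangible phi' -> dominates phi' phi ->
     dominates phi' (tangible_lift phiP phiS)).
Proof.
split; last exact: dominates_tangible_lift.
split; [exact: tangible_lift_supervaluation | exact: tangible_lift_tangible].
Qed.
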